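(* Let $F:\mathbb{R}^m\to\mathbb{R}^a$ be a vector valued function, where $m\ge1$, $a\ge1$. For a fixed $x\in\mathbb{R}^m$, let $k$ entries of $x$ be observed at random: for a fixed probability distribution $\mathbb{P}$ on the set $S_m$ of permutations of $[m]$ and a random $\sigma\sim\mathbb{P}$, the observed tuple is $\{\sigma,x_{\sigma(1)},\dots,x_{\sigma(k)}\}$. (1) A necessary condition for the existence of an unbiased estimator of $F(x)$ that can be constructed from $\{\sigma,x_{\sigma(1)},\dots,x_{\sigma(k)}\}$ is that it should be possible to decompose $F(x)$ over $k$ (or less) coordinates of $x$ at a time; that is, $F$ should have the structure $$F(x)=\sum_{(i_1,\dots,i_\ell)\in{}^{m}P_{\ell}}h_{i_1,\dots,i_\ell}(x_{i_1},\dots,x_{i_\ell}),$$ where $\ell\le k$ and $h_{i_1,\dots,i_\ell}:\mathbb{R}^\ell\to\mathbb{R}^a$ are (possibly different) functions. (2) Moreover, when $F(x)$ can be written in this form with $\ell=k$, an unbiased estimator of $F(x)$ based on $\{\sigma,x_{\sigma(1)},\dots,x_{\sigma(k)}\}$ is $$g(\sigma,x_{\sigma(1)},\dots,x_{\sigma(k)})=\frac{\sum_{(j_1,\dots,j_k)\in S_k}h_{\sigma(j_1),\dots,\sigma(j_k)}(x_{\sigma(j_1)},\dots,x_{\sigma(j_k)})}{\sum_{(j_1,\dots,j_k)\in S_k}p(\sigma(j_1),\dots,\sigma(j_k))}.$$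
   Context: ${}^{m}P_{\ell}$ is the set of $\ell$-permutations of $m$, i.e. ordered $\ell$-tuples of distinct elements of $[m]=\{1,\dots,m\}$; $S_k$ is the set of the $k!$ permutations $(j_1,\dots,j_k)$ of $[k]$. For distinct $j_1,\dots,j_k\in[m]$, $p(j_1,\dots,j_k)=\sum_{\pi\in S_m}\mathbb{P}(\pi)\,\mathbb{1}(\pi(1)=j_1,\dots,\pi(k)=j_k)$ is the total probability of the permutations whose first $k$ objects are $j_1,\dots,j_k$ in order. An unbiased estimator of $F(x)$ constructed from the observed tuple is a function $G$ with $\mathbb{E}_{\sigma\sim\mathbb{P}}[G(\sigma,x_{\sigma(1)},\dots,x_{\sigma(k)})]=F(x)$ for every $x\in\mathbb{R}^m$.
   Formalization: Part (2) is proved assuming that wherever the denominator of g vanishes its numerator is identically zero (e.g. all denominators nonzero); otherwise it fails: m=2, k=1, P concentrated on the identity, F(x)=x_1+x_2 gives E[g]=x_1. *)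

(* Defs.v *)
From HB Require Import structures.
From mathcomp Require Import all_boot all_order all_algebra all_fingroup.
From mathcomp Require Import reals.

Set Implicit Arguments.
Unset Strict Implicit.
Unset Printing Implicit Defensive.

Import Order.TTheory GRing.Theory Num.Theory.
Local Open Scope ring_scope.

Definition is_distribution (R : realType) (T : finType) (P : T -> R) : Prop :=
  (forall t, 0 <= P t) /\ \sum_t P t = 1.

(* (x_{i_1}, ..., x_{i_l}) *)
Definition coords (R : realType) (m l : nat) (x : 'rV[R]_m)
    (i : l.-tuple 'I_m) : 'rV[R]_l :=
  \row_(r < l) x 0 (tnth i r).

(* (sigma(1), ..., sigma(k)) *)
Definition prefix_of (m k : nat) (hk : (k <= m)%N) (sigma : 'S_m) :
    k.-tuple 'I_m :=
  [tuple sigma (widen_ord hk r) | r < k].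

(* (sigma(j_1), ..., sigma(j_k)) for (j_1, ..., j_k) in S_k, where j_r = j r *)
Definition prefix_at (m k : nat) (hk : (k <= m)%N) (sigma : 'S_m)
    (j : 'S_k) : k.-tuple 'I_m :=
  [tuple sigma (widen_ord hk (j r)) | r < k].

Definition prefix_prob (R : realType) (m k : nat) (hk : (k <= m)%N)
    (P : 'S_m -> R) (j : k.-tuple 'I_m) : R :=
  \sum_(pi : 'S_m) P pi * (prefix_of hk pi == j)%:R.

(* An estimator is an arbitrary function of sigma and of the k observed values;
   its expectation is a finite sum over 'S_m. *)
Definition unbiased (R : realType) (m k a : nat) (hk : (k <= m)%N)
    (P : 'S_m -> R) (F : 'rV[R]_m -> 'rV[R]_a)
    (G : 'S_m -> 'rV[R]_k -> 'rV[R]_a) : Prop :=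
  forall x : 'rV[R]_m,
    \sum_(sigma : 'S_m) P sigma *: G sigma (coords x (prefix_of hk sigma))
    = F x.

(* The l-permutations of m are the duplicate-free l-tuples over 'I_m; the
   values of h at tuples with repetitions play no role. *)
Definition decomposes (R : realType) (m a l : nat)
    (F : 'rV[R]_m -> 'rV[R]_a)
    (h : l.-tuple 'I_m -> 'rV[R]_l -> 'rV[R]_a) : Prop :=
  forall x : 'rV[R]_m,
    F x = \sum_(i : l.-tuple 'I_m | uniq i) h i (coords x i).

(* The observed vector is y = (x_{sigma(1)}, ..., x_{sigma(k)}), so that
   x_{sigma(j_r)} is the entry y_{j_r}. *)
Definition est_num (R : realType) (m k a : nat) (hk : (k <= m)%N)
    (h : k.-tuple 'I_m -> 'rV[R]_k -> 'rV[R]_a)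
    (sigma : 'S_m) (y : 'rV[R]_k) : 'rV[R]_a :=
  \sum_(j : 'S_k) h (prefix_at hk sigma j) (\row_(r < k) y 0 (j r)).

Definition est_den (R : realType) (m k : nat) (hk : (k <= m)%N)
    (P : 'S_m -> R) (sigma : 'S_m) : R :=
  \sum_(j : 'S_k) prefix_prob hk P (prefix_at hk sigma j).

Definition est (R : realType) (m k a : nat) (hk : (k <= m)%N)
    (P : 'S_m -> R) (h : k.-tuple 'I_m -> 'rV[R]_k -> 'rV[R]_a)
    (sigma : 'S_m) (y : 'rV[R]_k) : 'rV[R]_a :=
  (est_den hk P sigma)^-1 *: est_num hk h sigma y.

(* The quotient est_num / est_den has no pole: its denominator vanishes only
   where its numerator is identically zero (in particular this holds when
   est_den is nonzero everywhere). Denominators are automatically positive on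
   the support of P, but without this condition est misses the terms of F
   carried by the k-subsets that are never observed: for m = 2, k = 1 and P
   concentrated on the identity, F x = x_1 + x_2 has the required form but
   est has expectation x_1. *)
Definition no_pole (R : realType) (m k a : nat) (hk : (k <= m)%N)
    (P : 'S_m -> R) (h : k.-tuple 'I_m -> 'rV[R]_k -> 'rV[R]_a) : Prop :=
  forall sigma : 'S_m, est_den hk P sigma = 0 ->
    forall y : 'rV[R]_k, est_num hk h sigma y = 0.

(* Main.v *)
(* In both parts the sum over permutations is grouped by the ordered prefix
   [t = (sigma(1), ..., sigma(k))].  This alone proves (1), with
   [h_t = \sum_(sigma with prefix t) P(sigma) G(sigma, -)].  For (2), [S_k] acts
   on prefixes by reordering, the denominator [D(t)] is the orbit sum of the
   prefix probability [p] and the numerator is the orbit sum of the terms of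
   [F].  Moving the orbit sum from one factor to the other turns the expectation
   [\sum_t p(t)/D(t) \sum_j h(t.j)] into [\sum_t D(t)/D(t) h(t)].  On the
   orbits where [D] vanishes the terms of [F] have zero sum, so they do not
   contribute to [F] either. *)
Require Import Defs.
From HB Require Import structures.
From mathcomp Require Import all_boot all_order all_algebra all_fingroup.
From mathcomp Require Import primitive_action alt.
From mathcomp Require Import reals.

Set Implicit Arguments.
Unset Strict Implicit.
Unset Printing Implicit Defensive.

Import Order.TTheory GRing.Theory Num.Theory.
Local Open Scope ring_scope.

Definition perm_tuple (T : Type) (k : nat) (t : k.-tuple T) (j : 'S_k) :
    k.-tuple T :=
  [tuple tnth t (j r) | r < k].

Lemma tnth_perm_tuple (T : Type) (k : nat) (t : k.-tuple T) (j : 'S_k) r :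
  tnth (perm_tuple t j) r = tnth t (j r).
Proof. by rewrite tnth_mktuple. Qed.

(** Products in ['S_k] compose from left to right, so reordering is a left action. *)
Lemma perm_tupleM (T : Type) (k : nat) (t : k.-tuple T) (i j : 'S_k) :
  perm_tuple (perm_tuple t j) i = perm_tuple t (i * j)%g.
Proof. by apply: eq_from_tnth => r; rewrite !tnth_perm_tuple permM. Qed.

Lemma perm_tuple1 (T : Type) (k : nat) (t : k.-tuple T) : perm_tuple t 1%g = t.
Proof. by apply: eq_from_tnth => r; rewrite tnth_perm_tuple perm1. Qed.

Lemma perm_tupleK (T : Type) (k : nat) (j : 'S_k) :
  cancel (fun t : k.-tuple T => perm_tuple t j)
         (fun t => perm_tuple t j^-1%g).
Proof. by move=> t; rewrite perm_tupleM mulVg perm_tuple1. Qed.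

Lemma perm_tupleVK (T : Type) (k : nat) (j : 'S_k) :
  cancel (fun t : k.-tuple T => perm_tuple t j^-1%g)
         (fun t => perm_tuple t j).
Proof. by move=> t; rewrite perm_tupleM mulgV perm_tuple1. Qed.

Lemma uniq_perm_tuple (T : eqType) (k : nat) (t : k.-tuple T) (j : 'S_k) :
  uniq (perm_tuple t j) = uniq t.
Proof.
apply/tuple_uniqP/tuple_uniqP => tI r s.
  move=> trs; apply: (perm_inj (s := j^-1%g)); apply: tI.
  by rewrite !tnth_perm_tuple !permKV.
by rewrite !tnth_perm_tuple => /tI /perm_inj.
Qed.

Lemma sum_perm_tuple (V : nmodType) (T : finType) (k : nat) (j : 'S_k)
    (f : k.-tuple T -> V) :
  \sum_(t : k.-tuple T | uniq t) f (perm_tuple t j)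
  = \sum_(t : k.-tuple T | uniq t) f t.
Proof.
rewrite [RHS](reindex (fun t => perm_tuple t j)) /=; last first.
  by apply: onW_bij; exists (fun t => perm_tuple t j^-1%g);
    [exact: perm_tupleK | exact: perm_tupleVK].
by apply: eq_bigl => t; rewrite uniq_perm_tuple.
Qed.

(** The index is the group rather than the orbit; on duplicate-free tuples the action is free and
    the two sums agree. *)
Definition orbit_sum (V : nmodType) (T : Type) (k : nat) (f : k.-tuple T -> V)
    (t : k.-tuple T) : V :=
  \sum_(j : 'S_k) f (perm_tuple t j).

Lemma orbit_sum_perm_tuple (V : nmodType) (T : Type) (k : nat)
    (f : k.-tuple T -> V) (t : k.-tuple T) (i : 'S_k) :
  orbit_sum f (perm_tuple t i) = orbit_sum f t.
Proof.
rewrite /orbit_sum [RHS](reindex_inj (mulIg i)).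
by apply: eq_bigr => j _; rewrite perm_tupleM.
Qed.

(** Each reordering permutes the duplicate-free tuples, so moving it from [H] to [g] replaces [j] by
    its inverse, and inversion permutes ['S_k]. *)
Lemma sum_scale_orbit_sum (R : pzRingType) (V : lmodType R) (T : finType)
    (k : nat) (g : k.-tuple T -> R) (H : k.-tuple T -> V) :
  \sum_(t : k.-tuple T | uniq t) g t *: orbit_sum H t
  = \sum_(t : k.-tuple T | uniq t) orbit_sum g t *: H t.
Proof.
under eq_bigr do rewrite scaler_sumr.
under [RHS]eq_bigr do rewrite scaler_suml.
rewrite exchange_big [RHS]exchange_big /= [RHS](reindex_inj invg_inj) /=.
apply: eq_bigr => j _.
rewrite -[RHS](sum_perm_tuple j); apply: eq_bigr => t _.
by rewrite perm_tupleK.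
Qed.

Lemma tnth_prefix_of (m k : nat) (hk : (k <= m)%N) (sigma : 'S_m) r :
  tnth (prefix_of hk sigma) r = sigma (widen_ord hk r).
Proof. by rewrite tnth_mktuple. Qed.

Lemma uniq_prefix_of (m k : nat) (hk : (k <= m)%N) (sigma : 'S_m) :
  uniq (prefix_of hk sigma).
Proof.
apply/tuple_uniqP => r s; rewrite !tnth_prefix_of => /perm_inj rs.
by apply/val_inj/(congr1 val rs).
Qed.

(** The symmetric group is [k]-transitive, so some [sigma] carries the prefix of the identity to
    [t]. This turns facts about every [sigma] into facts about every duplicate-free tuple. *)
Lemma prefix_of_surj (m k : nat) (hk : (k <= m)%N) (t : k.-tuple 'I_m) :
  uniq t -> exists sigma : 'S_m, prefix_of hk sigma = t.
Proof.
move=> t_uniq.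
have kT : (k <= #|'I_m|)%N by rewrite card_ord.
have /atransP2 transk := ntransitive_weak kT (@Sym_trans 'I_m).
have dtupleT (u : k.-tuple 'I_m) : uniq u -> u \in dtuple_on k [set: 'I_m].
  by move=> u_uniq; rewrite inE u_uniq; apply/subsetP => z; rewrite inE.
have [sigma _ ->] := transk _ _ (dtupleT _ (uniq_prefix_of hk 1%g))
                                (dtupleT _ t_uniq).
exists sigma; apply: eq_from_tnth => r.
by rewrite tnth_prefix_of tnth_map tnth_prefix_of perm1.
Qed.

Lemma prefix_atE (m k : nat) (hk : (k <= m)%N) (sigma : 'S_m) (j : 'S_k) :
  prefix_at hk sigma j = perm_tuple (prefix_of hk sigma) j.
Proof.
by apply: eq_from_tnth => r; rewrite tnth_perm_tuple tnth_prefix_of tnth_mktuple.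
Qed.

Section Estimator.

Variables (R : realType) (m a k : nat) (hk : (k <= m)%N).
Variables (P : 'S_m -> R) (h : k.-tuple 'I_m -> 'rV[R]_k -> 'rV[R]_a).

Lemma sum_prefix_of (W : 'S_m -> 'rV[R]_a) :
  \sum_sigma W sigma
  = \sum_(t : k.-tuple 'I_m | uniq t)
      \sum_(sigma | prefix_of hk sigma == t) W sigma.
Proof. by apply: partition_big => sigma _; apply: uniq_prefix_of. Qed.

Lemma expectation_prefix_of (Q : k.-tuple 'I_m -> 'rV[R]_a) :
  \sum_sigma P sigma *: Q (prefix_of hk sigma)
  = \sum_(t : k.-tuple 'I_m | uniq t) prefix_prob hk P t *: Q t.
Proof.
rewrite sum_prefix_of; apply: eq_bigr => t _.
rewrite scaler_suml big_mkcond; apply: eq_bigr => sigma _.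
by case: eqP => [->|_]; rewrite ?mulr1 // mulr0 scale0r.
Qed.

Lemma est_denE (sigma : 'S_m) :
  est_den hk P sigma = orbit_sum (prefix_prob hk P) (prefix_of hk sigma).
Proof. by apply: eq_bigr => j _; rewrite prefix_atE. Qed.

Lemma est_numE (x : 'rV[R]_m) (sigma : 'S_m) :
  est_num hk h sigma (coords x (prefix_of hk sigma))
  = orbit_sum (fun t => h t (coords x t)) (prefix_of hk sigma).
Proof.
apply: eq_bigr => j _; rewrite prefix_atE; congr h.
by apply/rowP => r; rewrite !mxE tnth_perm_tuple.
Qed.

End Estimator.

Lemma unbiased_decomposes (R : realType) (m a k : nat) (hk : (k <= m)%N)
    (P : 'S_m -> R) (F : 'rV[R]_m -> 'rV[R]_a)
    (G : 'S_m -> 'rV[R]_k -> 'rV[R]_a) :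
  unbiased hk P F G ->
  decomposes F (fun t y =>
    \sum_(sigma | prefix_of hk sigma == t) P sigma *: G sigma y).
Proof.
move=> GF x; rewrite -GF (sum_prefix_of hk).
(* Within one group all [sigma] observe the same coordinates of [x], those listed in [t]. *)
by apply: eq_bigr => t _; apply: eq_bigr => sigma /eqP ->.
Qed.

Lemma est_unbiased (R : realType) (m a k : nat) (hk : (k <= m)%N)
    (P : 'S_m -> R) (F : 'rV[R]_m -> 'rV[R]_a)
    (h : k.-tuple 'I_m -> 'rV[R]_k -> 'rV[R]_a) :
  decomposes F h -> no_pole hk P h -> unbiased hk P F (est hk P h).
Proof.
move=> Fh nopole x; rewrite Fh.
pose p := prefix_prob hk P; pose D := orbit_sum p.
pose H t := h t (coords x t).
(* This is [no_pole] at the observation of [x], for any [sigma] with prefix [t]. *)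
have NH0 (t : k.-tuple 'I_m) : uniq t -> D t = 0 -> orbit_sum H t = 0.
  move=> /(prefix_of_surj hk) [sigma <-] D0.
  by rewrite -est_numE nopole // est_denE.
transitivity (\sum_(t : k.-tuple 'I_m | uniq t) (p t / D t) *: orbit_sum H t).
  under eq_bigr do rewrite /est est_denE est_numE.
  rewrite (expectation_prefix_of hk P (fun t => (D t)^-1 *: orbit_sum H t)).
  by apply: eq_bigr => t _; rewrite scalerA.
rewrite sum_scale_orbit_sum.
(* [D] is constant on orbits, so its inverse factors out of the orbit sum. *)
have -> : \sum_(t : k.-tuple 'I_m | uniq t)
            orbit_sum (fun t => p t / D t) t *: H t
          = \sum_(t : k.-tuple 'I_m | uniq t) (D t / D t) *: H t.
  apply: eq_bigr => t _; congr (_ *: _); rewrite /D {3}/orbit_sum mulr_suml.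
  by apply: eq_bigr => j _; rewrite orbit_sum_perm_tuple.
(* Since the inverse of 0 is 0, [1 - D t / D t] is the indicator of [D t = 0]. There only the orbit
   sum of [H] is known to vanish, not [H t] itself. Multiplying by [k!] brings in that orbit sum:
   the indicator is constant on orbits, so [k!] times it is its own orbit sum, which can be moved
   onto [H]. *)
apply/esym/eqP; rewrite -subr_eq0 -sumrB.
under eq_bigr do rewrite -{1}[h _ _]scale1r -scalerBl.
have fact_neq0 : (k`!%:R : R) != 0 by rewrite pnatr_eq0 -lt0n fact_gt0.
rewrite -(inj_eq (scalerI fact_neq0)) scaler0 scaler_sumr; apply/eqP.
transitivity (\sum_(t : k.-tuple 'I_m | uniq t)
                (1 - D t / D t) *: orbit_sum H t); last first.
  apply: big1 => t t_uniq; have [D0|D_neq0] := eqVneq (D t) 0.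
    by rewrite NH0 // scaler0.
  by rewrite divff // subrr scale0r.
rewrite sum_scale_orbit_sum; apply: eq_bigr => t _; rewrite scalerA.
congr (_ *: _); rewrite {1}/orbit_sum.
under eq_bigr do rewrite /D orbit_sum_perm_tuple.
by rewrite sumr_const card_Sn mulr_natl.
Qed.

Theorem lemma14 (R : realType) (m a k : nat)
    (hm : (1 <= m)%N) (ha : (1 <= a)%N) (hk : (k <= m)%N)
    (P : 'S_m -> R) (hP : is_distribution P)
    (F : 'rV[R]_m -> 'rV[R]_a) :
  ((exists G : 'S_m -> 'rV[R]_k -> 'rV[R]_a, unbiased hk P F G) ->
   exists l : nat, (l <= k)%N /\
     exists h : l.-tuple 'I_m -> 'rV[R]_l -> 'rV[R]_a, decomposes F h)
  /\
  (forall h : k.-tuple 'I_m -> 'rV[R]_k -> 'rV[R]_a,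
     decomposes F h -> no_pole hk P h -> unbiased hk P F (est hk P h)).
Proof.
split=> [[G GF]|h]; last exact: est_unbiased.
exists k; split=> //; eexists; exact: unbiased_decomposes GF.
Qed.
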